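(* Let $\mathbb E_\omega^\bullet$ be the poset (ordered by inclusion) of nontrivial cellular finitary entourages on $\omega$. Then: (1) ${\downarrow}{\uparrow}{\downarrow}(\mathbb E_\omega^\bullet)={\uparrow}{\downarrow}{\uparrow}(\mathbb E_\omega^\bullet)=1$. (2) ${\uparrow\uparrow}(\mathbb E_\omega^\bullet)={\downarrow\downarrow}(\mathbb E_\omega^\bullet)={\downarrow}(\mathbb E_\omega^\bullet)={\uparrow}(\mathbb E_\omega^\bullet)=\mathfrak c$. (3) $\mathrm{cov}(\mathcal M)\le{\downarrow}{\uparrow}(\mathbb E_\omega^\bullet)\le\widehat{\mathsf{\Delta}}$. (4) $\mathsf{\Sigma}\le{\uparrow}{\downarrow}(\mathbb E_\omega^\bullet)\le\mathrm{non}(\mathcal M)$.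
   Context: An entourage on $\omega$ is a set $E\subseteq\omega\times\omega$ containing the diagonal $\Delta_\omega$; $E(x)=\{y:(x,y)\in E\}$. It is cellular if it is an equivalence relation; a cellular entourage is finitary if $\sup_{x\in\omega}|E(x)|<\omega$; an entourage is trivial if $E\setminus\Delta_\omega$ is finite, and nontrivial otherwise. For a poset $P$, $x\in P$ and $S\subseteq P$: ${\downarrow}x=\{p\in P:p\le x\}$, ${\uparrow}x=\{p\in P:x\le p\}$, ${\downarrow}S=\bigcup_{s\in S}{\downarrow}s$, ${\uparrow}S=\bigcup_{s\in S}{\uparrow}s$; compositions are applied right to left, e.g. ${\uparrow\downarrow}S={\uparrow}({\downarrow}S)$, ${\downarrow\uparrow\downarrow}S={\downarrow}({\uparrow}({\downarrow}S))$. For each word $w$ among ${\downarrow}$, ${\uparrow}$, ${\uparrow}{\downarrow}$, ${\downarrow}{\uparrow}$, ${\downarrow}{\uparrow}{\downarrow}$, ${\uparrow}{\downarrow}{\uparrow}$, put $w(P)=\min\{|C|:C\subseteq P,\ wC=P\}$. Further, ${\uparrow\uparrow}(P)=\sup\{|C|:C\subseteq P\wedge\forall x,y\in C\ (x\ne y\Rightarrow{\uparrow}x\cap{\uparrow}y=\emptyset)\}$, ${\downarrow\downarrow}(P)=\sup\{|C|:C\subseteq P\wedge\forall x,y\in C\ (x\ne y\Rightarrow{\downarrow}x\cap{\downarrow}y=\emptyset)\}$. $[\omega]^\omega$ is the family of infinite subsets of $\omega$, $S_\omega$ the group of bijections of $\omega$, $I_\omega$ the set of involutions of $\omega$ with at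 most one fixed point, and $$\mathsf{\Sigma}=\min\{|H|:H\subseteq S_\omega\wedge\forall A,B\in[\omega]^\omega\ \exists h\in H\ h[A]\cap B\in[\omega]^\omega\},$$ $$\widehat{\mathsf{\Delta}}=\min\{|\mathcal A|:\mathcal A\subseteq[\omega]^\omega\wedge\forall h\in I_\omega\ \exists A\in\mathcal A\ |h[A]\cap A|<\omega\}.$$ $\mathcal M$ is the $\sigma$-ideal of meager subsets of $\mathbb R$; $\mathrm{cov}(\mathcal M)$ is the smallest cardinality of a subfamily of $\mathcal M$ covering $\mathbb R$, $\mathrm{non}(\mathcal M)$ the smallest cardinality of a non-meager subset of $\mathbb R$; $\mathfrak c=2^{\aleph_0}$. *)

(* Defs.v *)
From HB Require Import structures.
From Corelib Require Import RelationClasses.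
From mathcomp Require Import all_boot all_order all_algebra.
From mathcomp Require Import all_classical all_reals all_analysis.

Set Implicit Arguments.
Unset Strict Implicit.
Unset Printing Implicit Defensive.

Import Order.TTheory.
Import numFieldNormedType.Exports.

Local Open Scope classical_set_scope.
Local Open Scope card_scope.

(* A cardinal is represented by a set having that cardinality, and cardinals
   are compared by the heterogeneous relations #<= and #=.  [min_card Phi] is
   thus a member of Phi of least cardinality; cardinals being well-ordered, the
   default value set0 is used only if Phi is empty (see [min_cardP]). *)
Definition min_card {T : Type} (Phi : set (set T)) : set T :=
  xget set0 [set C | Phi C /\ forall D, Phi D -> C #<= D].

(* The least cardinal that is >= |C| for all C in Phi.  Every cardinal below
   |T| is that of a subset of T, so restricting to bounds K : set T loses
   nothing. *)
Definition sup_card {T : Type} (Phi : set (set T)) : set T :=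
  min_card [set K | forall C, Phi C -> C #<= K].

Lemma min_card_ex {T : Type} (Phi : set (set T)) :
  Phi !=set0 -> exists C, Phi C /\ forall D, Phi D -> C #<= D.
Proof.
case=> A0 PA0.
pose good (F : set (set T -> T)) :=
  (forall f A, F f -> Phi A -> A (f A)) /\
  (forall f g A, F f -> F g -> Phi A -> f A = g A -> f = g).
have [|F [[Fin Finj] Fmax]] := @Zorn_bigcup _ good.
  move=> G Ggood Gtot; split=> [f A [X GX Xf] PA|f g A [X GX Xf] [Y GY Yg] PA].
    exact: (Ggood _ GX).1 Xf PA.
  case: (Gtot _ _ GX GY) => sXY.
    by apply: (Ggood _ GY).2 => //; exact: sXY.
  by apply: (Ggood _ GX).2 => //; exact: sXY.
have [[A [PA AF]]|noA] :=
    pselect (exists A, Phi A /\ A `<=` (fun f => f A) @` F).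
  exists A; split=> // B PB.
  apply: card_le_trans (subset_card_le AF) _.
  apply: card_le_trans (card_image_le _ _) _.
  have injB : {in F &, injective (fun f : set T -> T => f B)}.
    by move=> f g /set_mem Ff /set_mem Fg; exact: Finj.
  move: (inj_card_eq injB); rewrite card_eq_le => /andP[_ le1].
  apply: card_le_trans le1 _; apply: subset_card_le.
  by move=> _ [f Ff <-]; exact: (Fin f B Ff PB).
have out A : Phi A -> exists a, A a /\ ~ ((fun f => f A) @` F) a.
  move=> PA; apply: contrapT => no; apply: noA; exists A; split=> // a Aa.
  by apply: contrapT => na; apply: no; exists a.
have [t0 _] := out _ PA0.
have /choice[g gP] : forall A, exists a,
    Phi A -> A a /\ ~ ((fun f => f A) @` F) a.
  move=> A; have [PA|nPA] := pselect (Phi A); last by exists t0.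
  by have [a] := out A PA; exists a.
have gnF : ~ F g by move=> Fg; have [_ ng] := gP _ PA0; apply: ng; exists g.
exfalso; apply: (Fmax (F `|` [set g])).
  split=> [f Ff|sub]; first by left.
  by apply: gnF; apply: sub; right.
split=> [f A [Ff|->] PA|f h A [Ff|->] [Fh|->] PA fh //].
- exact: (Fin f A Ff PA).
- by have [] := gP _ PA.
- exact: (Finj f h A Ff Fh PA fh).
- by have [_ ng] := gP _ PA; case: ng; exists f.
- by have [_ ng] := gP _ PA; case: ng; exists h.
Qed.

Lemma min_cardP {T : Type} (Phi : set (set T)) : Phi !=set0 ->
  Phi (min_card Phi) /\ forall D, Phi D -> min_card Phi #<= D.
Proof.
move=> /min_card_ex[C CP]; rewrite /min_card.
by case: xgetP => [X _ XP|/(_ C)/(_ CP)].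
Qed.

Lemma sup_cardP {T : Type} (Phi : set (set T)) :
  (forall C, Phi C -> C #<= sup_card Phi) /\
  forall L : set T, (forall C, Phi C -> C #<= L) -> sup_card Phi #<= L.
Proof. by apply: min_cardP; exists setT => C _; exact: card_leT. Qed.

Definition continuum : set (set nat) := [set: set nat].

Section Posets.
Context {d : Order.disp_t} {P : porderType d}.
Implicit Types S : set P.

Definition downset1 (x : P) : set P := [set p | (p <= x)%O].

Definition upset1 (x : P) : set P := [set p | (x <= p)%O].

Definition downset S : set P := \bigcup_(s in S) downset1 s.

Definition upset S : set P := \bigcup_(s in S) upset1 s.

End Posets.

Definition word_card d (P : porderType d) (w : set P -> set P) : set P :=
  min_card [set C | w C = [set: P]].

Definition upup d (P : porderType d) : set P :=
  sup_card [set C : set P | forall x y, C x -> C y -> x <> y ->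
    upset1 x `&` upset1 y = set0].

Definition downdown d (P : porderType d) : set P :=
  sup_card [set C : set P | forall x y, C x -> C y -> x <> y ->
    downset1 x `&` downset1 y = set0].

Arguments word_card {d} P w.
Arguments upup {d} P.
Arguments downdown {d} P.

Definition is_entourage (E : set (nat * nat)) : Prop := diagonal `<=` E.

Definition cellular (E : set (nat * nat)) : Prop :=
  Equivalence (fun x y => E (x, y)).

Definition finitary (E : set (nat * nat)) : Prop :=
  exists n : nat, forall x, xsection E x #<= `I_n.

Definition trivial_entourage (E : set (nat * nat)) : Prop :=
  finite_set (E `\` diagonal).

Definition nontrivial_cellular_finitary (E : set (nat * nat)) : Prop :=
  [/\ is_entourage E, cellular E, finitary E & ~ trivial_entourage E].

Record cf_entourage := CFEntourage {
  cf_val :> set (nat * nat);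
  _ : `[< nontrivial_cellular_finitary cf_val >] }.

HB.instance Definition _ := [isSub for cf_val].
HB.instance Definition _ := [Choice of cf_entourage by <:].

Fact cf_display : Order.disp_t. Proof. exact: Order.Disp tt tt. Qed.

HB.instance Definition _ :=
  [SubChoice_isSubPOrder of cf_entourage by <: with cf_display].

Lemma cf_leE (E F : cf_entourage) :
  (E <= F)%O = (cf_val E `<=` cf_val F) :> Prop.
Proof. by rewrite -subsetEset. Qed.

Definition Sigma_card : set (nat -> nat) :=
  min_card [set H : set (nat -> nat) |
    H `<=` [set h | bijective h] /\
    forall A B : set nat, infinite_set A -> infinite_set B ->
      exists2 h, H h & infinite_set (h @` A `&` B)].

Definition I_omega : set (nat -> nat) :=
  [set h | involutive h /\ forall x y, h x = x -> h y = y -> x = y].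

Definition Delta_hat_card : set (set nat) :=
  min_card [set F : set (set nat) |
    F `<=` [set A | infinite_set A] /\
    forall h, I_omega h -> exists2 A, F A & finite_set (h @` A `&` A)].

Definition nowhere_dense {T : topologicalType} (A : set T) : Prop :=
  (closure A)° = set0.

Definition meager {T : topologicalType} (A : set T) : Prop :=
  exists2 F : (set T)^nat, (forall n, nowhere_dense (F n)) &
    A = \bigcup_n F n.

Definition cov_meager_card (R : realType) : set (set R) :=
  min_card [set F : set (set R) |
    F `<=` meager /\ \bigcup_(A in F) A = [set: R]].

Definition non_meager_card (R : realType) : set R :=
  min_card [set A : set R | ~ meager A].

Arguments cov_meager_card R : clear implicits.
Arguments non_meager_card R : clear implicits.

(* Main.v *)
Require Import Defs.
From mathcomp Require Import all_boot all_order all_algebra.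
From mathcomp Require Import all_classical all_reals all_analysis.
From mathcomp Require Import zify lra.

(** The whole theorem is about matchings, i.e. symmetric relations M on nat in
    which every point has at most one partner: the diagonal together with M is
    a cellular entourage with classes of size at most 2.  Two facts make
    matchings sufficient.  A nontrivial finitary E contains infinitely many
    disjoint pairs, and they can be chosen so sparse that, for a second
    finitary F, the F-classes met by different pairs are different
    ([discrete_pairs]); then F and the pairs have a finitary join, whose classes
    are at most twice as large as those of F ([merge_pairs]).  Conversely, a
    colouring of the points that is injective on each class splits a finitary
    entourage into finitely many matchings ([matching_cover]).  A family of
    disjoint pairs is coded by one injective sequence w, the pairs being
    (w 0, w 1), (w 2, w 3), and so on.

    Three arrows.  By the first fact any E contains a nontrivial E' that has an
    upper bound in common with any given F ([weakly_compatible]), so one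
    entourage is enough.

    Antichains and cofinality.  There are at most continuum many entourages.
    Two matchings of a ray whose union is the whole ray, chosen independently in
    each of countably many copies of the ray according to a subset of nat,
    give continuum many entourages of which no two have a common upper bound
    ([zigzag_join]); the pairs along the branches of the binary tree give
    continuum many of which no two have a common lower bound ([branch_meet]).  A
    single member of a cofinal (coinitial) family serves at most one of these.

    Bounds by category.  The binary digits of a real r select a set of edges
    on nat; keeping the edges that meet no earlier selected edge yields a
    matching.  For a fixed nontrivial E and generic r this matching contains
    infinitely many edges of E ([cohen_hits_dense], [cohen_meets]) and links
    edges of E into arbitrarily long paths ([cohen_links_dense],
    [cohen_join]).  Thus the reals whose matching is compatible with E from
    above, as well as those whose matching is incompatible with E from below,
    form a meager set.  This gives the bounds by cov(M) and non(M).

    The two combinatorial bounds.  If every E meets nontrivially some member c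
    of a family C, apply this to pairs joining A to B: one of the finitely many
    involutions into which c splits maps infinitely many points of A into B.
    In the other direction, let a family of infinite sets be such that every
    involution h has a member A with h[A] meeting A in a finite set.  Composing
    enumerations of its members along a finite word makes finitely many
    matchings, hence a given finitary F, sparse one after the other
    ([word_discrete]); consecutive points of the resulting sequence are then
    joined as in the first fact.  Both arguments replace a family by finite
    words over it, which is harmless because an infinite set X has no more
    finite words than elements ([card_words], by Zorn's lemma). *)

Set Implicit Arguments.
Unset Strict Implicit.
Unset Printing Implicit Defensive.

Local Open Scope classical_set_scope.
Local Open Scope card_scope.

(** * Cardinality and infinite sets *)

Lemma card_le_inj T U (A : set T) (B : set U) (f : T -> U) :
  (forall x, A x -> B (f x)) ->
  (forall x y, A x -> A y -> f x = f y -> x = y) -> A #<= B.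
Proof.
move=> fAB finj.
have : {in A &, injective f}.
  by move=> x y /set_mem Ax /set_mem Ay; exact: finj.
move=> /inj_card_eq; rewrite card_eq_le => /andP[_ le1].
by apply: card_le_trans le1 _; apply: subset_card_le => _ [x Ax <-]; exact: fAB.
Qed.

Lemma finite_ub (A : set nat) :
  finite_set A -> exists N, forall x, A x -> (x < N)%N.
Proof.
move=> /finite_seqP[s ->]; exists (\max_(x <- s) x).+1 => x /= xs.
by rewrite ltnS; exact: leq_bigmax_seq.
Qed.

Lemma infinite_inj T (A : set T) (f : nat -> T) :
  (forall k, A (f k)) -> injective f -> infinite_set A.
Proof.
move=> Af finj; apply/infiniteP; apply: (@card_le_inj _ _ _ _ f) => //.
by move=> x y _ _; exact: finj.
Qed.

Lemma infinite_enum T (A : set T) :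
  infinite_set A -> exists f : nat -> T, (forall k, A (f k)) /\ injective f.
Proof.
move=> /infiniteP /card_leP[f].
have Af k : A (val (f (exist _ k (mem_set I)))).
  exact: set_valP.
exists (fun k => val (f (exist _ k (mem_set I)))); split=> // i j.
by move=> /val_inj /(@inj _ _ _ f _ _ (mem_set I) (mem_set I)) [].
Qed.


(** * Colourings, matchings and disjoint pairs *)

Local Notation nontrivial E := (~ trivial_entourage E).

Lemma nontrivialS E F : E `<=` F -> nontrivial E -> nontrivial F.
Proof. by move=> EF; apply: contra_not; apply: sub_finite_set => p [/EF]. Qed.

(** A colouring with n colours is a convenient witness of finitarity: it
    bounds all classes at once, and it labels the matchings into which the
    entourage splits. *)
Definition coloring n (c : nat -> nat) (E : set (nat * nat)) :=
  (forall x, (c x < n)%N) /\ forall x y, E (x, y) -> c x = c y -> x = y.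

Lemma coloring_finitary n c E : coloring n c E -> cellular E -> finitary E.
Proof.
move=> [cn cE] [Er Es Et]; exists n => x.
apply: (@card_le_inj _ _ _ _ c) => [y _|y z]; first exact: cn.
rewrite /xsection /= !inE => xy xz; apply: cE.
by apply: Et xz; exact: Es.
Qed.

(** Each class injects into `I_n; the injection has to be the same for all the
    points of a class, hence the choice of a representative. *)
Lemma finitary_coloring (E : set (nat * nat)) :
  cellular E -> finitary E -> exists n c, coloring n c E.
Proof.
move=> [Er Es Et] [n En].
have /choice[f fP] : forall x, exists f : nat -> nat,
    (forall y, E (x, y) -> (f y < n)%N) /\
    forall y z, E (x, y) -> E (x, z) -> f y = f z -> y = z.
  move=> x; have /pcard_leP[f] := En x; exists f; split=> [y xy|y z xy xz].
    by apply: (@funS _ _ _ _ f); rewrite /xsection /= inE.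
  by apply: (@inj _ _ _ f); rewrite inE /xsection /= inE.
pose rep x := get [set y | E (x, y)].
have repP x : E (x, rep x) by apply: (@getPex _ [set y | E (x, y)]); exists x.
have repE x y : E (x, y) -> rep x = rep y.
  move=> xy; rewrite /rep; congr get; apply/seteqP; split=> z /= h.
    by apply: Et h; exact: Es.
  exact: Et h.
exists n, (fun x => f (rep x) x); split=> [x|x y xy].
  by apply: (fP _).1; apply: Es.
rewrite (repE _ _ xy); apply: (fP _).2; apply: Es => //.
by rewrite -(repE _ _ xy).
Qed.

Lemma finitary_class E x : finitary E -> finite_set [set y | E (x, y)].
Proof.
move=> [n /(_ x) En]; apply/finite_set_leP; exists n; apply: card_le_trans En.
by apply: subset_card_le => y /= xy; rewrite /xsection /= inE.
Qed.

Definition matching (M : nat -> nat -> Prop) :=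
  (forall x y, M x y -> M y x) /\ (forall x y z, M x y -> M x z -> y = z).

Definition match_ent (M : nat -> nat -> Prop) : set (nat * nat) :=
  [set p | p.1 = p.2 \/ M p.1 p.2].

Lemma match_ent_cellular M : matching M -> cellular (match_ent M).
Proof.
move=> [Ms Mf]; split; rewrite /match_ent /=.
- by left.
- by move=> x y [->|/Ms]; [left|right].
- move=> x y z [->//|xy] [<-|yz]; first by right.
  by left; apply: (Mf y) => //; exact: Ms.
Qed.

Lemma match_ent_finitary M : matching M -> finitary (match_ent M).
Proof.
move=> MM; have [Ms Mf] := MM.
apply: (@coloring_finitary 2 (fun x => `[< exists2 y, M x y & (y < x)%N >] : nat));
  last exact: match_ent_cellular.
split=> [x|x y [//|/= xy]]; first by case: `[< _ >].
have h u v : M u v -> `[< exists2 y, M u y & (y < u)%N >] = (v < u)%N.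
  move=> uv; apply/asboolP/idP => [[w uw]|]; last by exists v.
  by rewrite (Mf u v w).
rewrite (h x y)// (h y x)//; last exact: Ms.
by case: ltngtP.
Qed.

Lemma match_ent_P M : matching M -> nontrivial (match_ent M) ->
  nontrivial_cellular_finitary (match_ent M).
Proof.
move=> MM nt; split=> //; last exact: match_ent_finitary.
- by move=> [x y]; rewrite /diagonal /= => ->; left.
- exact: match_ent_cellular.
Qed.

(** The matching formed by (w 0, w 1), (w 2, w 3), ...; disjointness of the
    pairs is just injectivity of w. *)
Definition pairs (w : nat -> nat) x y :=
  exists k, (x = w k.*2 /\ y = w k.*2.+1) \/ (y = w k.*2 /\ x = w k.*2.+1).

Lemma pairs_matching w : injective w -> matching (pairs w).
Proof.
move=> wi; split=> [x y [k h]|x y z [k h] [l h']]; first by exists k; tauto.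
case: h h' => [[-> ->]|[-> ->]] [[/wi e ->]|[-> /wi e]];
  by [congr w; lia | exfalso; lia].
Qed.

Lemma nontrivial_pairs w E : injective w ->
  (forall k, E (w k.*2, w k.*2.+1)) -> nontrivial E.
Proof.
move=> wi wE; apply: (@infinite_inj _ _ (fun k => (w k.*2, w k.*2.+1))).
  by move=> k; split=> //=; rewrite /diagonal /= => /wi; lia.
by move=> i j [/wi + _]; lia.
Qed.

Lemma pairs_P w : injective w -> nontrivial_cellular_finitary (match_ent (pairs w)).
Proof.
move=> wi; apply: match_ent_P; first exact: pairs_matching.
by apply: (nontrivial_pairs wi) => k; right; exists k; left.
Qed.

(** Pairs are picked one at a time, each outside the finite set of neighbours
    of the points already used.  The history [h m] lists the points of the first
    m pairs. *)
Lemma greedy (N : nat -> set nat) (S : nat -> set (nat * nat)) :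
  (forall x, finite_set (N x)) ->
  (forall m K, finite_set K -> exists x y, [/\ S m (x, y), ~ K x & ~ K y]) ->
  exists w : nat -> nat, forall m, S m (w m.*2, w m.*2.+1) /\
    forall i j, (i < m.*2)%N -> (j = m.*2 \/ j = m.*2.+1) -> ~ N (w i) (w j).
Proof.
move=> Nfin SP.
pose K (s : seq nat) := \bigcup_(x in [set` s]) N x.
have Kfin s : finite_set (K s).
  by apply: bigcup_finite => // ; exact: finite_seq.
have /choice[g gP] : forall ms : nat * seq nat, exists p,
    [/\ S ms.1 p, ~ K ms.2 p.1 & ~ K ms.2 p.2].
  by move=> [m s]; have [x [y []]] := SP m _ (Kfin s); exists (x, y).
pose h := fix h m := if m is m'.+1 then
   let p := g (m', h m') in rcons (rcons (h m') p.1) p.2 else [::].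
have sh m : size (h m) = m.*2 by elim: m => //= m ih; rewrite !size_rcons ih.
have hst m l n : (n < m.*2)%N -> nth 0%N (h (m + l)) n = nth 0%N (h m) n.
  move=> nm; elim: l => [|l ihl]; first by rewrite addn0.
  rewrite addnS /= nth_rcons size_rcons sh ifT; last by lia.
  by rewrite nth_rcons sh ifT//; lia.
pose w n := nth 0%N (h n.+1) n.
have hw m n : (n < m.*2)%N -> nth 0%N (h m) n = w n.
  move=> nm; rewrite -(hst m n.+1)// addnC hst//; lia.
have w0 m : w m.*2 = (g (m, h m)).1.
  by rewrite -(hw m.+1) ?doubleS//= nth_rcons size_rcons sh ltnSn nth_rcons sh ltnn eqxx.
have w1 m : w m.*2.+1 = (g (m, h m)).2.
  by rewrite -(hw m.+1) ?doubleS//= nth_rcons size_rcons sh ltnn eqxx.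
exists w => m; have [/= Sg g1 g2] := gP (m, h m).
split=> [|i j im jm Nij]; first by rewrite w0 w1 -surjective_pairing.
have : K (h m) (w j).
  by exists (w i) => //=; rewrite -(hw m)// mem_nth// sh.
by case: jm => ->; rewrite ?w0 ?w1.
Qed.

(** With the F-classes as neighbourhoods, points of different pairs are never
    F-related; two points of the same pair may be. *)
Lemma greedy_pairs F (S : nat -> set (nat * nat)) :
  cellular F -> finitary F ->
  (forall m K, finite_set K ->
    exists x y, [/\ S m (x, y), x <> y, ~ K x & ~ K y]) ->
  exists w, [/\ injective w, forall m, S m (w m.*2, w m.*2.+1) &
    forall i j, F (w i, w j) -> i./2 = j./2].
Proof.
move=> [Fr Fs _] Ff SP.
have Sne m K : finite_set K ->
    exists x y, [/\ [set p | S m p /\ p.1 <> p.2] (x, y), ~ K x & ~ K y].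
  by move=> /(SP m)[x [y []]]; exists x, y.
have Nf x : finite_set [set y | F (x, y)] by exact: finitary_class.
have [w wP] := @greedy _ (fun m => [set p | S m p /\ p.1 <> p.2]) Nf Sne.
have Fw i j : F (w i, w j) -> i./2 = j./2.
  wlog : i j / (i./2 <= j./2)%N.
    move=> H Fij; case: (leqP i./2 j./2) => h; first exact: H.
    by symmetry; apply: H; [exact: ltnW|exact: Fs].
  rewrite leq_eqVlt => /orP[/eqP//|lt Fij].
  by exfalso; apply: ((wP j./2).2 i j) => //; lia.
exists w; split=> // [i j wij|m]; last exact: (wP m).1.1.
have : i./2 = j./2 by apply: Fw; rewrite wij; exact: Fr.
have := (wP i./2).1.2 => /= ne ij.
apply: contrapT => nij; apply: ne.
have [[-> ->]|[-> ->]] : (i./2.*2 = i /\ i./2.*2.+1 = j) \/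
  (i./2.*2 = j /\ i./2.*2.+1 = i) by lia.
all: by rewrite wij.
Qed.

(** The edges meeting a finite set K lie in the finite square of the union of
    the classes that K meets. *)
Lemma fresh_edge E K : cellular E -> finitary E -> nontrivial E -> finite_set K ->
  exists x y, [/\ E (x, y), x <> y, ~ K x & ~ K y].
Proof.
move=> [_ Es _] Ef nt Kf; apply: contrapT => no; apply: nt.
have Lf : finite_set (\bigcup_(x in K) [set y | E (x, y)]).
  by apply: bigcup_finite => // x _; exact: finitary_class.
have Uf : finite_set (K `|` \bigcup_(x in K) [set y | E (x, y)]).
  by rewrite finite_setU.
apply: sub_finite_set (finite_setX Uf Uf) => -[x y] [/= Exy]; rewrite /diagonal /= => xy.
have [Kx|nKx] := pselect (K x); first by split; [left|right; exists x].
have [Ky|nKy] := pselect (K y).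
  by split; [right; exists y => //=; exact: Es|left].
by case: no; exists x, y.
Qed.

Lemma discrete_pairs E F : cellular E -> finitary E -> nontrivial E ->
  cellular F -> finitary F ->
  exists w, [/\ injective w, forall m, E (w m.*2, w m.*2.+1) &
    forall i j, F (w i, w j) -> i./2 = j./2].
Proof.
move=> Ec Ef Ent Fc Ff; apply: (greedy_pairs (S := fun=> E)) => // _ K Kf.
exact: fresh_edge.
Qed.

(** Since different pairs meet different F-classes, joining each pair fuses at
    most two classes of F. *)
Lemma merge_pairs F w : cellular F -> finitary F ->
  (forall i j, F (w i, w j) -> i./2 = j./2) ->
  exists G, [/\ cellular G, finitary G, F `<=` G &
    forall k, G (w k.*2, w k.*2.+1)].
Proof.
move=> Fc Ff Fw; have [n [c [cn cF]]] := finitary_coloring Fc Ff.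
have [Fr Fs Ft] := Fc.
pose S k x := F (w k.*2, x) \/ F (w k.*2.+1, x).
have SF k x y : S k x -> F (x, y) -> S k y.
  by move=> [h|h] xy; [left|right]; exact: Ft xy.
have Suniq k l x : S k x -> S l x -> k = l.
  have e a b : F (a, x) -> F (b, x) -> F (a, b) by move=> h /Fs; exact: Ft.
  by move=> [h|h] [h'|h']; have := Fw _ _ (e _ _ h h'); lia.
pose G : set (nat * nat) := [set p | F p \/ exists k, S k p.1 /\ S k p.2].
have Gc : cellular G.
  split=> [x|x y [/Fs|[k [? ?]]]|x y z]; first by left; exact: Fr.
  - by left.
  - by right; exists k.
  - case=> [xy|[k [/= kx ky]]] [yz|[l [/= ly lz]]].
    + by left; exact: Ft yz.
    + by right; exists l; split=> //; apply: SF (ly) _; exact: Fs.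
    + by right; exists k; split=> //; exact: SF yz.
    + by right; exists k; split=> //; rewrite (Suniq k l y).
exists G; split=> //; last 2 first.
- by left.
- by move=> k; right; exists k; split; [left|right]; exact: Fr.
(* In a fused class the points F-related to the first end of the pair keep
   their colour, the others get a second copy of the colours. *)
pose a x := `[< exists k, F (w k.*2, x) >].
apply: (@coloring_finitary (n + n) (fun x => if a x then c x else n + c x)%N) => //.
split=> [x|x y Gxy].
  by case: (a x); have := cn x; lia.
have aP k z : S k z -> a z -> F (w k.*2, z).
  move=> Sz /asboolP[l lz]; suff <- : l = k by [].
  by apply: Suniq Sz; left.
have naP k z : S k z -> ~~ a z -> F (w k.*2.+1, z).
  by case=> // kz /asboolP; case; exists k.
have [aE|aE] := eqVneq (a x) (a y); last first.
  by have := cn x; have := cn y; move: aE; case: (a x); case: (a y) => //= _; lia.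
rewrite -aE => ce; apply: cF; last by move: ce; case: (a x); lia.
case: Gxy => // -[k [/= kx ky]].
have [ax|ax] := boolP (a x).
  by apply: Ft (aP k y ky _); [exact/Fs/aP|rewrite -aE].
by apply: Ft (naP k y ky _); [exact/Fs/naP|rewrite -aE].
Qed.

(** * The words with three arrows *)

Lemma cf_valP (E : cf_entourage) : nontrivial_cellular_finitary E.
Proof. by case: E => E h; exact/asboolP. Qed.

Lemma cf_of E : nontrivial_cellular_finitary E -> exists E' : cf_entourage, cf_val E' = E.
Proof. by move=> /asboolT h; exists (CFEntourage h). Qed.

Lemma cf_ub (E : cf_entourage) F : cf_val E `<=` F -> cellular F -> finitary F ->
  exists2 G : cf_entourage, cf_val G = F & (E <= G)%O.
Proof.
move=> EF Fc Ff; have [] := @cf_of F.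
  have [Ed _ _ Ent] := cf_valP E; split=> //; first by move=> p /Ed /EF.
  exact: nontrivialS EF Ent.
by move=> G GF; exists G => //; rewrite cf_leE GF.
Qed.

Lemma cf_pairs w : injective w -> exists E : cf_entourage, cf_val E = match_ent (pairs w).
Proof. by move=> /pairs_P/cf_of. Qed.

Lemma pairs_sub w E : cellular E -> (forall m, E (w m.*2, w m.*2.+1)) ->
  match_ent (pairs w) `<=` E.
Proof.
by move=> [Er Es _] wE [x y] [/= ->|[k /= [[-> ->]|[-> ->]]]] => //; exact: Es.
Qed.

(** The pairs extracted from E are an entourage below E, and their join with F
    is finitary. *)
Lemma weakly_compatible (E F : cf_entourage) : exists E' G : cf_entourage,
  [/\ (E' <= E)%O, (E' <= G)%O & (F <= G)%O].
Proof.
have [_ Ec Ef Ent] := cf_valP E; have [_ Fc Ff _] := cf_valP F.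
have [w [wi wE wF]] := discrete_pairs Ec Ef Ent Fc Ff.
have [G0 [Gc Gf FG wG]] := merge_pairs Fc Ff wF.
have [E' E'E] := cf_pairs wi; have [G GE FG'] := cf_ub FG Gc Gf.
by exists E', G; split=> //; rewrite cf_leE E'E ?GE; exact: pairs_sub.
Qed.

Lemma word_card1 (w : set cf_entourage -> set cf_entourage) :
  w set0 = set0 -> (forall E : cf_entourage, w [set E] = setT) ->
  word_card cf_entourage w #= `I_1.
Proof.
move=> w0 w1; have [E _] := cf_pairs (@inj_id nat).
have [|wP le] := @min_cardP _ [set C | w C = [set: cf_entourage]].
  by exists [set E]; exact: w1.
rewrite card_eq_le /word_card; apply/andP; split.
  apply: card_le_trans (le [set E] (w1 E)) _.
  by move: (@card_set1 _ E); rewrite card_eq_le => /andP[].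
have [F Fm] : min_card [set C | w C = [set: cf_entourage]] !=set0.
  apply/set0P/negP => /eqP e; move: wP; rewrite /= e w0 => /seteqP[_ /(_ E)].
  exact.
apply: card_le_trans (subset_card_le (_ : [set F] `<=` _)).
  by move: (@card_set1 _ F); rewrite card_eq_le => /andP[].
by move=> _ ->.
Qed.

Lemma downset0 d (P : porderType d) : downset set0 = set0 :> set P.
Proof. exact: bigcup_set0. Qed.

Lemma upset0 d (P : porderType d) : upset set0 = set0 :> set P.
Proof. exact: bigcup_set0. Qed.

Lemma down_up_down1 (E : cf_entourage) :
  (downset \o upset \o downset) [set E] = setT.
Proof.
apply/seteqP; split=> // F _; have [E' [G [E'E E'G FG]]] := weakly_compatible E F.
by exists G => //; exists E' => //; exists E.
Qed.

Lemma up_down_up1 (E : cf_entourage) :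
  (upset \o downset \o upset) [set E] = setT.
Proof.
apply/seteqP; split=> // F _; have [E' [G [E'E E'G FG]]] := weakly_compatible F E.
by exists E' => //; exists G => //; exists E.
Qed.

Lemma three_letter_words_card :
  word_card cf_entourage (downset \o upset \o downset) #= `I_1 /\
  word_card cf_entourage (upset \o downset \o upset) #= `I_1.
Proof.
split; apply: word_card1 => [|E].
- by rewrite /comp downset0 upset0 downset0.
- exact: down_up_down1.
- by rewrite /comp upset0 downset0 upset0.
- exact: up_down_up1.
Qed.

(** * Antichains and cofinality *)

(** Position j of the i-th copy of nat inside nat. *)
Definition node (i j : nat) : nat := pickle (i, j).

(** On the n-th copy of the ray 0, 1, 2, ... the points are matched as 01, 23,
    45, ... if n is not in a, and as 12, 34, 56, ... if it is.  On a copy where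
    a and b differ, the two matchings together make the whole ray connected. *)
Definition zigzag (a : set nat) x y := exists n k,
  let x0 := node n (k.*2 + (n \in a)) in
  let y0 := node n (k.*2 + (n \in a)).+1 in
  (x = x0 /\ y = y0) \/ (y = x0 /\ x = y0).

Lemma node_inj (i j k l : nat) :
  node i j = node k l -> i = k /\ j = l.
Proof. by move=> /(pcan_inj pickleK)[]. Qed.

Lemma zigzag_matching a : matching (zigzag a).
Proof.
split=> [x y [n [k /= h]]|x y z [n [k /= h]] [n' [k' /= h']]].
  by exists n, k => /=; tauto.
case: h h' => [[-> ->]|[-> ->]] [[/node_inj[<- e] ->]|[-> /node_inj[<- e]]];
  by [congr node; lia | exfalso; lia].
Qed.

Lemma zigzag_P a : nontrivial_cellular_finitary (match_ent (zigzag a)).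
Proof.
apply: match_ent_P; first exact: zigzag_matching.
apply: (@infinite_inj _ _ (fun k => (node 0 (k.*2 + (0%N \in a)),
    node 0 (k.*2 + (0%N \in a)).+1))).
  move=> k; split=> /=; first by right; exists 0%N, k; left.
  by rewrite /diagonal /= => /node_inj[_]; lia.
by move=> i j /(congr1 fst)/= /node_inj[_]; lia.
Qed.

Lemma zigzag_join a b G : ~ (a `<=` b) ->
  match_ent (zigzag a) `<=` G -> match_ent (zigzag b) `<=` G ->
  cellular G -> ~ finitary G.
Proof.
move=> /existsNP[n /not_implyP[an nbn]] aG bG [Gr Gs Gt] Gf.
have step j : G (node n j, node n j.+1).
  have [jo|je] := boolP (odd j).
    apply: aG; right; exists n, j./2; left; rewrite (mem_set an).
    by split; congr node; lia.
  apply: bG; right; exists n, j./2; left; rewrite (memNset nbn).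
  by split; congr node; lia.
have chain j : G (node n 0, node n j).
  by elim: j => [|j ih]; [exact: Gr|exact: Gt ih (step j)].
move: (@finitary_class G (node n 0) Gf).
apply: (@infinite_inj _ _ (fun j => node n j)) => // i j.
by move=> /node_inj[].
Qed.

(** The node at height n on the branch a of the binary tree: distinct branches
    share only finitely many nodes, which gives almost disjoint sets. *)
Definition code (a : set nat) n := pickle [seq i \in a | i <- iota 0 n].

Lemma code_inj a b m n : code a m = code b n ->
  m = n /\ forall i, (i < m)%N -> (i \in a) = (i \in b).
Proof.
move=> /(pcan_inj pickleK) e.
have mn : m = n by move: (congr1 size e); rewrite !size_map !size_iota.
split=> // i im; subst n.
have := congr1 (fun s => nth true s i) e.
by rewrite !(nth_map 0%N) ?size_iota// !nth_iota.
Qed.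

Definition branch (a : set nat) n := ((code a n./2).*2 + odd n)%N.

Lemma branch_inj a : injective (branch a).
Proof.
move=> m n; rewrite /branch => e.
have /code_inj[h _] : code a m./2 = code a n./2 by lia.
have : odd m = odd n by lia.
by lia.
Qed.

Lemma branch_meet a b G : ~ (a `<=` b) ->
  G `<=` match_ent (pairs (branch a)) -> G `<=` match_ent (pairs (branch b)) ->
  trivial_entourage G.
Proof.
move=> /existsNP[n /not_implyP[an nbn]] Ga Gb.
have brE c k : branch c k.*2 = (code c k).*2 /\ branch c k.*2.+1 = (code c k).*2.+1.
  by rewrite /branch /= uphalf_double doubleK odd_double addn0 addn1.
pose B := [set x | exists2 i, (i <= n)%N & x = branch a i.*2 \/ x = branch a i.*2.+1].
have Bf : finite_set B.
  have -> : B = (fun i => branch a i.*2) @` `I_n.+1 `|`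
      (fun i => branch a i.*2.+1) @` `I_n.+1.
    apply/seteqP; split=> [x [i ni [->|->]]|x [[i ni <-]|[i ni <-]]].
    - by left; exists i.
    - by right; exists i.
    - by exists i => //; left.
    - by exists i => //; right.
  by rewrite finite_setU; split; apply: finite_image; exact: finite_II.
apply: sub_finite_set (finite_setX Bf Bf) => -[x y] [Gxy]; rewrite /diagonal /= => xy.
have [/= //|[k /= hk]] := Ga _ Gxy; have [/= //|[l /= hl]] := Gb _ Gxy.
have kn : (k <= n)%N.
  rewrite leqNgt; apply/negP => nk.
  have [_ /(_ n nk)] : k = l /\ forall i, (i < k)%N -> (i \in a) = (i \in b).
    by apply: code_inj; move: (brE a k) (brE b l); lia.
  by rewrite (mem_set an) (memNset nbn).
by case: hk => [[-> ->]|[-> ->]]; split; exists k => //; tauto.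
Qed.

Lemma cf_entourage_le : [set: cf_entourage] #<= continuum.
Proof.
apply: (@card_le_inj _ _ _ _ (fun E : cf_entourage => pickle @` cf_val E)) => //.
move=> E F _ _ e; apply: val_inj => /=.
by apply/seteqP; split=> p Ep;
  [have : (pickle @` cf_val F) (pickle p) by rewrite -e; exists p
  |have : (pickle @` cf_val E) (pickle p) by rewrite e; exists p];
  move=> [q Fq /(pcan_inj pickleK) <-].
Qed.

(** For a symmetric property of two distinct sets, one may assume that some
    point belongs to the first set and not to the second. *)
Lemma not_subset_sym (P : set nat -> set nat -> Prop) :
  (forall a b, P a b -> P b a) -> (forall a b, ~ (a `<=` b) -> P a b) ->
  forall a b, a <> b -> P a b.
Proof.
move=> Ps Pn a b ab; have [sab|] := pselect (a `<=` b); last exact: Pn.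
by apply/Ps/Pn => sba; apply: ab; apply/seteqP.
Qed.

(** Both orders are treated together: [w1] is [upset1] or [downset1], and [f]
    indexes continuum many entourages whose cones [w1 (f a)] are pairwise
    disjoint. *)
Section Antichains.
Variables (f : set nat -> cf_entourage) (w1 : cf_entourage -> set cf_entourage).
Hypothesis w1r : forall E : cf_entourage, w1 E E.
Hypothesis fw : forall a b, a <> b -> w1 (f a) `&` w1 (f b) = set0.

Lemma antichain_inj : injective f.
Proof.
move=> a b e; apply: contrapT => /fw; rewrite e => /seteqP[/(_ (f b)) + _].
by apply; split; exact: w1r.
Qed.

Lemma sup_antichain : sup_card [set C : set cf_entourage | forall x y,
   C x -> C y -> x <> y -> w1 x `&` w1 y = set0] #= continuum.
Proof.
rewrite card_eq_le; apply/andP; split.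
  exact: card_le_trans (subset_card_le (@subsetT _ _)) cf_entourage_le.
apply: (@card_le_trans _ _ _ (range f)).
  by apply: (@card_le_inj _ _ _ _ f) => // x y _ _; exact: antichain_inj.
apply: (sup_cardP _).1 => _ _ [a _ <-] [b _ <-] ab; apply: fw => e.
by apply: ab; rewrite e.
Qed.

(** An element of the family that belongs to the cone of [f a] belongs to no
    other cone, so choosing one in each cone is injective. *)
Lemma cofinal_card (w : set cf_entourage -> set cf_entourage) :
  (forall C (E : cf_entourage), w C E -> exists2 F, C F & w1 E F) -> w setT = setT ->
  word_card cf_entourage w #= continuum.
Proof.
move=> wP wT; have [|wC _] := @min_cardP _ [set C | w C = [set: cf_entourage]].
  by exists setT.
rewrite card_eq_le; apply/andP; split.
  exact: card_le_trans (subset_card_le (@subsetT _ _)) cf_entourage_le.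
have /choice[g gP] a : exists F, word_card cf_entourage w F /\ w1 (f a) F.
  by have [|F ? ?] := wP (word_card cf_entourage w) (f a); [rewrite wC|exists F].
apply: (@card_le_inj _ _ _ _ g) => [a _|a b _ _ e]; first exact: (gP a).1.
apply: contrapT => /fw /seteqP[/(_ (g a)) + _]; apply.
by split; [exact: (gP a).2|rewrite e; exact: (gP b).2].
Qed.
End Antichains.

Lemma antichains_and_cofinality_card : [/\ upup cf_entourage #= continuum,
  downdown cf_entourage #= continuum,
  word_card cf_entourage downset #= continuum &
  word_card cf_entourage upset #= continuum].
Proof.
have /choice[f fP] a := cf_of (zigzag_P a).
have /choice[g gP] a := cf_pairs (@branch_inj a).
have fw a b : a <> b -> upset1 (f a) `&` upset1 (f b) = set0.
  move: a b; apply: not_subset_sym => [a b|a b ab]; first by rewrite setIC.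
  apply/seteqP; split=> // G [/=]; rewrite /upset1 /= !cf_leE !fP => aG bG.
  have [_ Gc Gf _] := cf_valP G.
  exact: (zigzag_join ab aG bG Gc Gf).
have gw a b : a <> b -> downset1 (g a) `&` downset1 (g b) = set0.
  move: a b; apply: not_subset_sym => [a b|a b ab]; first by rewrite setIC.
  apply/seteqP; split=> // G [/=]; rewrite /downset1 /= !cf_leE !gP => aG bG.
  have [_ _ _ Gn] := cf_valP G.
  exact: (Gn (branch_meet ab aG bG)).
have rr (E : cf_entourage) : (E <= E)%O by rewrite cf_leE.
split.
- exact: (@sup_antichain f upset1 rr fw).
- exact: (@sup_antichain g downset1 rr gw).
- apply: (cofinal_card fw) => //.
  by apply/seteqP; split=> // E _; exists E => //; exact: rr.
- apply: (cofinal_card gw) => //.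
  by apply/seteqP; split=> // E _; exists E => //; exact: rr.
Qed.

(** * Finite words over an infinite set *)

(** Cardinals are well-ordered, so the pair A, B has a member of least
    cardinality. *)
Lemma card_le_total T (A B : set T) : A #<= B \/ B #<= A.
Proof.
have [|C [[->|->] le]] := @min_card_ex _ [set A; B]; first by exists A; left.
  by left; apply: le; right.
by right; apply: le; left.
Qed.

Definition words T (X : set T) : set (seq T) := [set s | all [in X] s].

Lemma wordsP T (X : set T) x s : words X (x :: s) <-> X x /\ words X s.
Proof.
split=> [/andP[/set_mem]//|[Xx Xs]]; apply/andP; split=> //; exact: mem_set.
Qed.

Lemma words_sub T (X Y : set T) : X `<=` Y -> words X `<=` words Y.
Proof. by move=> XY s; elim: s => // x s ih /wordsP[/XY ? /ih ?]; apply/wordsP. Qed.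

Lemma words_map T U (X : set T) (Y : set U) (f : T -> U) s :
  (forall x, X x -> Y (f x)) -> words X s -> words Y (map f s).
Proof.
by move=> fXY; elim: s => // x s ih /wordsP[/fXY ? /ih ?]; apply/wordsP.
Qed.

Lemma words_map_inj T U (X : set T) (f : T -> U) :
  (forall x y, X x -> X y -> f x = f y -> x = y) ->
  forall s t, words X s -> words X t -> map f s = map f t -> s = t.
Proof.
move=> fi; elim=> [|x s ih] [|y t]// /wordsP[Xx Xs] /wordsP[Xy Xt] [e /ih ->//].
by rewrite (fi x y).
Qed.

Lemma card_le_fun T U (A : set T) (B : set U) (u0 : U) : A #<= B ->
  exists f : T -> U, (forall x, A x -> B (f x)) /\
    forall x y, A x -> A y -> f x = f y -> x = y.
Proof.
move=> /card_leP[f].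
exists (fun x => if pselect (A x) is left Ax
  then val (f (exist _ x (mem_set Ax))) else u0); split=> [x Ax|x y Ax Ay].
  by case: pselect => // ?; exact: set_valP.
do 2!case: pselect => // ?.
by move=> /val_inj /(@inj _ _ _ f _ _ (mem_set I) (mem_set I)) [].
Qed.

Section WordsCard.
Variables (T : Type) (X : set T).
Hypothesis Xinf : infinite_set X.

(** The partial solutions to which Zorn's lemma is applied; D is infinite in
    order to contain the two tags used in the extension step. *)
Definition word_coding (p : set T * (seq T -> T)) := [/\ p.1 `<=` X,
  infinite_set p.1, forall s, words p.1 s -> p.1 (p.2 s) &
  forall s t, words p.1 s -> words p.1 t -> p.2 s = p.2 t -> s = t].

Lemma word_coding_base : exists p, word_coding p.
Proof.
have [e [eX ei]] := infinite_enum Xinf.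
have /choice[g gP] x : exists n, range e x -> x = e n.
  by have [[n _ <-]|] := pselect (range e x); [exists n|exists 0%N].
exists (range e, fun s => e (pickle (map g s))); split=> /=.
- by move=> _ [n _ <-].
- by apply: (@infinite_inj _ _ e) => // k; exists k.
- by move=> s _; exists (pickle (map g s)).
- move=> s t Xs Xt /ei /(pcan_inj pickleK); apply: words_map_inj Xs Xt.
  by move=> x y /gP {2}-> /gP {2}-> ->.
Qed.

Definition coding_le (p q : {p | word_coding p}) :=
  `[< (sval p).1 `<=` (sval q).1 /\
      forall s, words (sval p).1 s -> (sval p).2 s = (sval q).2 s >].

(** A word is finite, so its letters belong to a single member of the chain. *)
Lemma coding_chain (A : set {p | word_coding p}) : total_on A coding_le ->
  exists q, forall p, A p -> coding_le p q.
Proof.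
move=> Atot; have [p0 p0P] := word_coding_base.
have [[a Aa]|A0] := pselect (A !=set0); last first.
  by exists (exist _ p0 p0P) => p Ap; case: A0; exists p.
pose D := \bigcup_(p in A) (sval p).1.
have Dw s : words D s -> exists2 p, A p & words (sval p).1 s.
  elim: s => [_|x s ih /wordsP[[p Ap px] /ih[q Aq qs]]]; first by exists a.
  case: (Atot p q Ap Aq) => /asboolP[sub _].
    by exists q => //; apply/wordsP; split=> //; exact: sub.
  by exists p => //; apply/wordsP; split=> //; exact: words_sub qs.
have agree p q s : A p -> A q -> words (sval p).1 s -> words (sval q).1 s ->
    (sval p).2 s = (sval q).2 s.
  move=> Ap Aq ps qs; case: (Atot p q Ap Aq) => /asboolP[_ e]; first exact: e.
  by symmetry; exact: e.
have /choice[f fP] s : exists y, forall p, A p -> words (sval p).1 s -> (sval p).2 s = y.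
  have [[p [Ap ps]]|no] := pselect (exists p, A p /\ words (sval p).1 s).
    by exists ((sval p).2 s) => q Aq qs; exact: agree.
  by exists ((sval a).2 s) => q Aq qs; case: no; exists q.
have good : word_coding (D, f).
  split=> /=.
  - by move=> x [p Ap]; have [+ _ _ _] := svalP p; exact.
  - have [_ + _ _] := svalP a; apply: contra_not; apply: sub_finite_set.
    by move=> x ax; exists a.
  - move=> s /Dw[p Ap ps]; exists p => //; rewrite -(fP s p)//.
    by have [_ _ + _] := svalP p; exact.
  - move=> s t /Dw[p Ap ps] /Dw[q Aq qt].
    have [r [Ar rs rt]] : exists r, [/\ A r, words (sval r).1 s & words (sval r).1 t].
      case: (Atot p q Ap Aq) => /asboolP[sub _].
        by exists q; split=> //; exact: words_sub ps.
      by exists p; split=> //; exact: words_sub qt.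
    rewrite -(fP s r)// -(fP t r)//.
    by have [_ _ _] := svalP r; exact.
exists (exist _ _ good) => p Ap; apply/asboolP; split=> /= [x px|s ps].
  by exists p.
exact: fP.
Qed.

(** Take a maximal partial solution (D, f).  If X \ D injects into D, then X
    has the size of D, because words of length two over D code two copies of D.
    Otherwise X \ D contains a copy of D, and the words that use a letter of
    this copy can be sent injectively into it, which contradicts maximality. *)
Lemma card_words : words X #<= X.
Proof.
have [p0 p0P] := word_coding_base.
have [|||[[D f] Dgood] Dmax] := @ZL_preorder _ (exist _ p0 p0P) coding_le.
- by move=> p; apply/asboolP; split=> x.
- move=> q p r /asboolP[pq epq] /asboolP[qr eqr]; apply/asboolP; split.
    exact: subset_trans pq qr.
  by move=> s ps; rewrite epq// eqr//; exact: words_sub ps.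
- exact: coding_chain.
have [/= DX Dinf fD fi] := Dgood.
have [e [eD ei]] := infinite_enum Dinf.
have w2 x y : D x -> D y -> words D [:: x; y] by move=> Dx Dy; rewrite /words /= !mem_set.
(* The tag e 0 marks the letters of D, and e 1 marks those that j brings back
   into D. *)
pose u (j : T -> T) (x : T) := if x \in D then f [:: e 0%N; x] else f [:: e 1%N; j x].
have uD j Y : (forall x, Y x -> ~ D x -> D (j x)) -> forall x, Y x -> D (u j x).
  move=> jD x Yx; rewrite /u; have [/set_mem Dx|nDx] := boolP (x \in D).
    by apply/fD/w2.
  by apply/fD/w2 => //; apply: jD => // Dx; move/negP: nDx; apply; exact: mem_set.
have ui j Y : (forall x, Y x -> ~ D x -> D (j x)) ->
  (forall x y, Y x -> Y y -> ~ D x -> ~ D y -> j x = j y -> x = y) ->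
  forall x y, Y x -> Y y -> u j x = u j y -> x = y.
  move=> jD ji x y Yx Yy; rewrite /u.
  have [/set_mem Dx|/negP nDx] := boolP (x \in D);
  have [/set_mem Dy|/negP nDy] := boolP (y \in D).
  - by move=> /(fi _ _ (w2 _ _ (eD _) Dx) (w2 _ _ (eD _) Dy))[].
  - have /(w2 _ _ (eD 1%N)) jy : D (j y) by apply: jD => // /mem_set.
    by move=> /(fi _ _ (w2 _ _ (eD _) Dx) jy)[/ei].
  - have /(w2 _ _ (eD 1%N)) jx : D (j x) by apply: jD => // /mem_set.
    by move=> /(fi _ _ jx (w2 _ _ (eD _) Dy))[/ei].
  - have /(w2 _ _ (eD 1%N)) jx : D (j x) by apply: jD => // /mem_set.
    have /(w2 _ _ (eD 1%N)) jy : D (j y) by apply: jD => // /mem_set.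
    by move=> /(fi _ _ jx jy)[]; apply: ji => // /mem_set.
case: (card_le_total (X `\` D) D) => [/(card_le_fun (e 0%N))[j [jD ji]]|].
  have jD' x : X x -> ~ D x -> D (j x) by move=> Xx nDx; exact: jD.
  apply: (@card_le_inj _ _ _ _ (fun s => f (map (u j) s))) => [s Xs|s t Xs Xt].
    by apply/DX/fD; apply: words_map Xs; exact: uD.
  move=> /fi e'; have uDX : forall x, X x -> D (u j x) by exact: uD.
  have : map (u j) s = map (u j) t by apply: e'; exact: words_map uDX _.
  apply: words_map_inj Xs Xt; apply: ui => // x y Xx Xy nDx nDy.
  by apply: ji.
move=> /(card_le_fun (e 0%N))[j [jD ji]]; exfalso.
have /choice[k kP] x : exists y, (j @` D) x -> D y /\ j y = x.
  have [[y Dy <-]|no] := pselect ((j @` D) x); first by exists y.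
  by exists (e 0%N).
pose D' := D `|` j @` D.
have kD x : D' x -> ~ D x -> D (k x) by case=> // /kP[].
have uD' := uD _ _ kD.
have ui' x y : D' x -> D' y -> u k x = u k y -> x = y.
  apply: ui kD _ x y => x y [//|/kP[_ jx]] [//|/kP[_ jy]] _ _ e'.
  by rewrite -jx -jy e'.
pose g s := if pselect (words D s) then f s else j (f (map (u k) s)).
have fk s : words D' s -> D (f (map (u k) s)).
  by move=> D's; apply: fD; exact: words_map D's.
have good : word_coding (D', g).
  split=> /=.
  - by move=> x [/DX//|[y /jD[Xy _] <-]].
  - by apply: contra_not Dinf; apply: sub_finite_set => x; left.
  - move=> s D's; rewrite /g; case: pselect => ws; first by left; exact: fD.
    by right; exists (f (map (u k) s)) => //; exact: fk.
  - move=> s t D's D't; rewrite /g; case: pselect => ws; case: pselect => wt /=.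
    + exact: fi.
    + by move=> h; have [_] := jD _ (fk _ D't); rewrite -h => /(_ (fD _ ws)).
    + by move=> h; have [_] := jD _ (fk _ D's); rewrite h => /(_ (fD _ wt)).
    + move=> /ji h; have {}h := h (fk _ D's) (fk _ D't).
      by apply: (words_map_inj ui') => //; apply: fi h; exact: words_map uD' _.
have /asboolP[+ _] : coding_le (exist _ _ good) (exist _ _ Dgood).
  apply: Dmax; apply/asboolP; split=> /= [x|s ws]; first by left.
  by rewrite /g; case: pselect.
move=> /(_ (j (e 0%N))) /= h; have [_] := jD _ (eD 0%N); apply; apply: h.
by right; exists (e 0%N).
Qed.

Lemma card_nat_words : [set p : nat * seq T | words X p.2] #<= X.
Proof.
apply: card_le_trans card_words; have [e [eX ei]] := infinite_enum Xinf.
apply: (@card_le_inj _ _ _ _ (fun p => e p.1 :: p.2)) => [[n s] /= Xs|].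
  exact/wordsP.
by move=> [n s] [m t] /= _ _ [/ei -> ->].
Qed.
End WordsCard.

(** * From entourages to involutions *)

Lemma matching_fun M : matching M -> exists h, [/\ involutive h,
  forall x y, M x y -> h x = y & forall x, h x = x \/ M x (h x)].
Proof.
move=> [Ms Mf].
have /choice[h hP] x : exists y, (M x y) \/ (y = x /\ ~ exists z, M x z).
  have [[y xy]|no] := pselect (exists y, M x y); first by exists y; left.
  by exists x; right.
have hM x y : M x y -> h x = y.
  by move=> xy; have [/Mf|[_]] := hP x; [exact|case; exists y].
exists h; split=> // x; last by have [|[-> _]] := hP x; [right|left].
by have [/Ms/hM//|[e _]] := hP x; rewrite !e.
Qed.

(** In a maximal matching extending M two unmatched points could be matched
    with each other, so at most one point is left. *)
Lemma perfect_extension M : matching M -> exists2 h, I_omega h &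
  forall x y, M x y -> x <> y -> h x = y.
Proof.
move=> [Ms Mf].
pose ext (R : set (nat * nat)) x y := (M x y /\ x <> y) \/ R (x, y).
pose good R := matching (ext R) /\ forall x, ~ R (x, x).
have [|R [[[Rs Rf] Rx] Rmax]] := @Zorn_bigcup _ good.
  move=> Q Qg Qtot; split=> [|x [R QR]]; last exact: (Qg _ QR).2.
  split=> [x y [[/Ms ? ?]|[R QR xy]]|x y z].
  - by left; split=> // e; subst.
  - have [[+ _] _] := Qg _ QR; move=> /(_ x y (or_intror xy)) [?|?]; first by left.
    by right; exists R.
  - have one R : Q R -> ext R x y -> ext R x z -> y = z.
      by move=> /Qg[[_ +] _]; exact.
    move=> [[xy nxy]|[R QR xy]] [[xz nxz]|[S QS xz]].
    + exact: Mf xy xz.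
    + by apply: (one S) => //; [left|right].
    + by apply: (one R) => //; [right|left].
    + case: (Qtot _ _ QR QS) => RS.
        by apply: (one S) => //; right=> //; exact: RS.
      by apply: (one R) => //; right=> //; exact: RS.
have [h [hh hM hx]] := matching_fun (conj Rs Rf).
exists h => [|x y xy nxy]; last by apply: hM; left.
split=> // x y hxx hyy; apply: contrapT => nxy.
have fixN z : h z = z -> forall t, ~ ext R z t.
  move=> e t zt; have tz := hM _ _ zt; rewrite e in tz; subst t.
  by case: zt => [[]//|/Rx].
have xN := fixN _ hxx; have yN := fixN _ hyy.
apply: (Rmax (R `|` [set p | p = (x, y) \/ p = (y, x)])).
  split=> [p|/(_ (x, y))]; first by left.
  by move=> sub; apply: (xN y); right; apply: sub; right; left.
have sN u v : ext R u v -> [/\ u <> x, u <> y, v <> x & v <> y].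
  move=> uv; have vu := Rs _ _ uv.
  by split=> e; subst; [exact: xN uv|exact: yN uv|exact: xN vu|exact: yN vu].
pose ext2 u v := ext R u v \/ (u = x /\ v = y) \/ (u = y /\ v = x).
have extE u v : ext (R `|` [set p | p = (x, y) \/ p = (y, x)]) u v <-> ext2 u v.
  split=> [[?|[?|[[-> ->]|[-> ->]]]]|[[?|?]|[[-> ->]|[-> ->]]]].
  - by left; left.
  - by left; right.
  - by right; left.
  - by right; right.
  - by left.
  - by right; left.
  - by right; right; left.
  - by right; right; right.
split=> [|z [/Rx//|[[zx zy]|[zy zx]]]]; try by apply: nxy; rewrite -zx -zy.
split=> [u v /extE uv|u v t /extE uv /extE ut].
  by apply/extE; case: uv => [/Rs|]; [left|right; tauto].
case: uv ut => [uv|[[-> ->]|[-> ->]]] [ut|[[e ->]|[e ->]]] //.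
- exact: Rf uv ut.
- by have [] := sN _ _ uv.
- by have [] := sN _ _ uv.
- by have [] := sN _ _ ut.
- by have [] := sN _ _ ut.
Qed.

(** The k-th matching joins the points of colours k %/ n and k %% n inside each
    class. *)
Lemma matching_cover (F : set (nat * nat)) : cellular F -> finitary F ->
  exists N (Ms : nat -> nat -> nat -> Prop), (forall k, matching (Ms k)) /\
    forall x y, F (x, y) -> exists2 k, (k < N)%N & Ms k x y.
Proof.
move=> Fc Ff; have [n [c [cn cF]]] := finitary_coloring Fc Ff; have [Fr Fs Ft] := Fc.
exists (n * n)%N, (fun k x y => F (x, y) /\
  ((c x = k %/ n /\ c y = k %% n) \/ (c y = k %/ n /\ c x = k %% n)))%N.
split=> [k|x y xy].
  split=> [x y [/Fs ? ?]|x y z [xy h] [xz h']]; first by split=> //; tauto.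
  by apply: cF; [exact: Ft (Fs _ _ xy) xz|lia].
exists (c x * n + c y)%N; first by move: (cn x) (cn y); nia.
split=> //; left; have n0 : (0 < n)%N by move: (cn x); lia.
by rewrite divnMDl// divn_small ?addn0// modnMDl modn_small.
Qed.

Lemma diagonal_match : diagonal = match_ent (fun _ _ => False).
Proof. by apply/seteqP; split=> [p|p []//]; left. Qed.

Lemma diagonal_cf : cellular (diagonal : set (nat * nat)) /\
  finitary (diagonal : set (nat * nat)).
Proof.
by rewrite diagonal_match; split;
  [apply: match_ent_cellular|apply: match_ent_finitary].
Qed.

Lemma infinite_fresh (A K : set nat) : infinite_set A -> finite_set K ->
  exists2 x, A x & ~ K x.
Proof.
move=> Ai Kf; apply: contrapT => no; apply: Ai; apply: sub_finite_set Kf => x Ax.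
by apply: contrapT => nK; apply: no; exists x.
Qed.

(** The sets may vary with m so that countably many requirements can each be
    met infinitely often. *)
Lemma pairs_into (A B : nat -> set nat) :
  (forall m, infinite_set (A m)) -> (forall m, infinite_set (B m)) ->
  exists2 w, injective w & forall m, A m (w m.*2) /\ B m (w m.*2.+1).
Proof.
move=> Ai Bi; have [Dc Df] := diagonal_cf.
have [|w [wi wS _]] := @greedy_pairs _ (fun m => A m `*` B m) Dc Df.
  move=> m K Kf; have [x Ax nKx] := infinite_fresh (Ai m) Kf.
  have Kxf : finite_set (K `|` [set x]) by rewrite finite_setU.
  have [y By nKy] := infinite_fresh (Bi m) Kxf.
  exists x, y; split=> // [e|Ky]; apply: nKy; last by left.
  by right.
by exists w => // m; have [] := wS m.
Qed.

(** * Sparse sets and the bound by Delta hat *)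

Definition delta_family (A : set (set nat)) := A `<=` [set B | infinite_set B] /\
  forall h, I_omega h -> exists2 B, A B & finite_set (h @` B `&` B).

(** The graph of an involution is a matching, and an infinite set that is
    discrete for it meets its own image in fixed points only. *)
Lemma delta_family_ex : exists A, delta_family A.
Proof.
exists [set B | infinite_set B]; split=> // h [hh hfix].
have hM : matching (fun x y => h x = y) by split=> [x y <-//|x y z -> //].
have [_ Ec Ef En] := pairs_P (@inj_id nat).
have [w [wi _ wF]] := discrete_pairs Ec Ef En
  (match_ent_cellular hM) (match_ent_finitary hM).
exists (range (fun k => w k.*2)).
  by apply: (@infinite_inj _ _ (fun k => w k.*2)) => // i j /wi; lia.
have [[x hx]|no] := pselect (exists x, h x = x).
  apply: sub_finite_set (finite_set1 x) => _ [[_ [k _ <-] <-] [l _ e]].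
  have kl : k = l by have := wF k.*2 l.*2 (or_intror (esym e)); lia.
  by subst l; apply: hfix => //; rewrite -e.
apply: sub_finite_set (@finite_set0 _) => _ [[_ [k _ <-] <-] [l _ e]].
have kl : k = l by have := wF k.*2 l.*2 (or_intror (esym e)); lia.
by subst l; case: no; exists (w k.*2).
Qed.

(** For finitely many infinite sets, one involution joins infinitely many pairs
    inside each of them. *)
Lemma delta_family_infinite A : delta_family A -> infinite_set A.
Proof.
move=> [Ai AP] /finite_seqP[s As].
(* Each of the sets is repeated infinitely often. *)
pose a m := nth setT s (m %% size s).
have aI m : infinite_set (a m).
  rewrite /a; have [lt|ge] := ltnP (m %% size s)%N (size s).
    by apply: Ai; rewrite As /= mem_nth.
  by rewrite nth_default//; exact: infinite_nat.
have [w wi wa] := pairs_into aI aI.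
have [h hI hw] := perfect_extension (pairs_matching wi).
have [B + Bfin] := AP h hI; rewrite As /= => /(nthP setT)[i isz iB].
apply: (_ : infinite_set (h @` B `&` B)) Bfin.
have aE j : a (j * size s + i)%N = B by rewrite /a modnMDl modn_small.
apply: (@infinite_inj _ _ (fun j => w (j * size s + i)%N.*2.+1)) => [j|j k].
  have [w1 w2] := wa (j * size s + i)%N; rewrite aE in w1 w2; split=> //.
  exists (w (j * size s + i)%N.*2) => //; apply: hw; first by eexists; left.
  by move=> /wi; lia.
move=> /wi e; have /eqP : (j * size s = k * size s)%N by lia.
by rewrite eqn_pmul2r ?(leq_trans _ isz)// => /eqP.
Qed.

Lemma enum_ex : exists en : set nat -> nat -> nat, forall A, infinite_set A ->
  (forall k, A (en A k)) /\ injective (en A).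
Proof.
have /choice[en enP] (A : set nat) : exists f : nat -> nat, infinite_set A ->
    (forall k, A (f k)) /\ injective f.
  have [/infinite_enum[f fP]|] := pselect (infinite_set A); first by exists f.
  by exists id.
by exists en.
Qed.

Section Words.
Variable en : set nat -> nat -> nat.
Hypothesis enP : forall A, infinite_set A -> (forall k, A (en A k)) /\ injective (en A).

Definition word_fun (s : seq (set nat)) : nat -> nat :=
  foldr (fun A b => en A \o b) id s.

(** Induction on the number of matchings: a member B makes the first one
    sparse, and pulling the others back along the enumeration of B gives
    matchings on nat, to which the induction hypothesis applies.  Passing to a
    subsequence preserves the sparseness already obtained. *)
Lemma word_discrete A : delta_family A ->
  forall N (Ms : nat -> nat -> nat -> Prop), (forall k, matching (Ms k)) ->
  exists s, [/\ words A s, injective (word_fun s) & forall k, (k < N)%N ->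
    finite_set [set p | p.1 <> p.2 /\ Ms k (word_fun s p.1) (word_fun s p.2)]].
Proof.
move=> [AI AP]; elim=> [|N ih] Ms MM; first by exists [::]; split=> // x y.
have [h hI hM] := perfect_extension (MM 0%N).
have [B AB Bfin] := AP h hI; have [enB eni] := enP (AI _ AB).
have [|s [As si sM]] := ih (fun k x y => Ms k.+1 (en B x) (en B y)).
  move=> k; have [Ms_ Mf] := MM k.+1.
  by split=> [x y /Ms_//|x y z xy xz]; apply: eni; exact: Mf xy xz.
have wi : injective (word_fun (B :: s)) by move=> x y /eni/si.
exists (B :: s); split=> //; first exact/wordsP.
case=> [_|k kN]; last exact: sM.
apply: card_le_finite Bfin.
apply: (@card_le_inj _ _ _ _ (fun p => word_fun (B :: s) p.2)).
  move=> [i j] /= [ij Mij]; split; last exact: enB.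
  by exists (en B (word_fun s i)); [exact: enB|apply: hM => // /eni/si].
move=> [i j] [k l] /= [_ ij] [_ kl] /eni/si jl; subst l.
by have [Ms_ Mf] := MM 0%N; rewrite (wi i k)//; apply: Mf (Ms_ _ _ ij) (Ms_ _ _ kl).
Qed.
End Words.

Lemma down_upP (C : set cf_entourage) :
  (downset \o upset) C = setT <->
  forall E : cf_entourage, exists c G : cf_entourage, [/\ C c, (c <= G)%O & (E <= G)%O].
Proof.
split=> [CT E|CP].
  by have : (downset \o upset) C E; [rewrite CT|case=> G [c Cc cG] EG; exists c, G].
by apply/seteqP; split=> // E _; have [c [G [Cc cG EG]]] := CP E; exists G => //; exists c.
Qed.

Lemma up_downP (C : set cf_entourage) :
  (upset \o downset) C = setT <->
  forall E : cf_entourage, exists c G : cf_entourage, [/\ C c, (G <= c)%O & (G <= E)%O].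
Proof.
split=> [CT E|CP].
  by have : (upset \o downset) C E; [rewrite CT|case=> G [c Cc cG] EG; exists c, G].
by apply/seteqP; split=> // E _; have [c [G [Cc cG EG]]] := CP E; exists G => //; exists c.
Qed.

Lemma word_card_le (w : set cf_entourage -> set cf_entourage) C :
  w C = setT -> word_card cf_entourage w #<= C.
Proof.
by move=> wC; have [|_] := @min_cardP _ [set C | w C = setT]; [exists C|exact].
Qed.

Lemma word_cardP (w : set cf_entourage -> set cf_entourage) C :
  w C = setT -> w (word_card cf_entourage w) = setT.
Proof. by move=> wC; have [] := @min_cardP _ [set C | w C = setT]; first by exists C. Qed.

(** The entourage attached to a number k and a word s pairs consecutive terms
    of the sequence of s from the k-th term on.  For a given F a suitable word
    makes the sequence F-discrete up to finitely many terms, and k drops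
    these. *)
Lemma down_up_le_Delta_hat : word_card cf_entourage (downset \o upset) #<= Delta_hat_card.
Proof.
have AP : delta_family Delta_hat_card := (min_cardP delta_family_ex).1.
set A := Delta_hat_card in AP *; have Ainf := delta_family_infinite AP.
have [en enP] := enum_ex.
pose w (p : nat * seq (set nat)) i := word_fun en p.2 (p.1 + i).
have [E0 _] := cf_pairs (@inj_id nat).
have /choice[g gP] p : exists E : cf_entourage,
    injective (word_fun en p.2) -> cf_val E = match_ent (pairs (w p)).
  have [pi|] := pselect (injective (word_fun en p.2)); last by exists E0.
  by have [|E EE] := @cf_pairs (w p); [move=> i j /pi; lia|exists E].
apply: card_le_trans (card_nat_words Ainf).
apply: card_le_trans (card_image_le g _); apply/word_card_le/down_upP => F.
have [_ Fc Ff _] := cf_valP F.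
have [N [Ms [MM MF]]] := matching_cover Fc Ff.
have [s [As si sM]] := word_discrete enP AP N MM.
have : finite_set [set p | p.1 <> p.2 /\ cf_val F (word_fun en s p.1, word_fun en s p.2)].
  apply: sub_finite_set (bigcup_finite (finite_II N) sM) => -[i j] /= [ij].
  by move=> /MF[k kN]; exists k.
move=> /(finite_image fst)/finite_ub[k kP].
have wF i j : cf_val F (w (k, s) i, w (k, s) j) -> i./2 = j./2.
  move=> Fij; apply: contrapT => ij; have : (k + i < k)%N.
    by apply: kP; exists ((k + i)%N, (k + j)%N) => //; split=> //= e; apply: ij; congr half; lia.
  by lia.
have [G0 [Gc Gf FG wG]] := merge_pairs Fc Ff wF; have [G GE FG'] := cf_ub FG Gc Gf.
exists (g (k, s)), G; split=> //.
by rewrite cf_leE (gP (k, s) si) GE; exact: (pairs_sub Gc wG).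
Qed.

(** * The bound by Sigma *)

(** Finitely many finitary entourages leave infinitely many disjoint pairs that
    belong to none of them. *)
Lemma up_down_infinite (C : set cf_entourage) :
  (upset \o downset) C = setT -> infinite_set C.
Proof.
move=> /up_downP CP Cf.
pose B x := \bigcup_(c in C) [set y | cf_val c (x, y)].
have Bf x : finite_set (B x).
  by apply: bigcup_finite => // c _; apply: finitary_class; have [] := cf_valP c.
have [Dc Df] := diagonal_cf.
have [_ K Kf|w [wi wC _]] := @greedy_pairs _ (fun=> [set p | ~ B p.1 p.2]) Dc Df.
  have [x _ nKx] := infinite_fresh infinite_nat Kf.
  have Kxf : finite_set (K `|` [set x] `|` B x) by rewrite !finite_setU.
  have [y _ nKy] := infinite_fresh infinite_nat Kxf.
  exists x, y; split=> // [By|e|Ky]; apply: nKy; [by right|by left; right|by left; left].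
have [E EE] := cf_pairs wi; have [c [G [Cc Gc GE]]] := CP E.
have [_ _ _ Gn] := cf_valP G; apply: Gn.
apply: sub_finite_set (@finite_set0 _) => -[x y] [Gxy]; rewrite /diagonal /= => xy.
move: Gc GE; rewrite !cf_leE EE => /(_ _ Gxy) cxy /(_ _ Gxy) [//|[k /= h]].
have [_ [_ cs _] _ _] := cf_valP c.
by apply: (wC k); exists c => //=; case: h => [[<- <-]//|[<- <-]]; exact: cs.
Qed.

(** The witnesses for Sigma are the countably many involutions attached to each
    c of an optimal family; as this family is infinite, there are no more of
    them than elements of the family.  Were every involution of c to map only
    finitely many points of A into B, then c would contain only finitely many
    of the pairs that join A to B. *)
Lemma Sigma_le_up_down : Sigma_card #<= word_card cf_entourage (upset \o downset).
Proof.
have CT : (upset \o downset) (word_card cf_entourage (upset \o downset)) = setT.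
  apply: (@word_cardP _ setT); apply/up_downP => E.
  by exists E, E; split=> //; rewrite cf_leE.
set C := word_card _ _ in CT *.
have /choice[h hP] : forall c : cf_entourage, exists h : nat -> nat -> nat,
    (forall k, involutive (h k)) /\
    exists N, forall x y, cf_val c (x, y) -> exists2 k, (k < N)%N & h k x = y.
  move=> c; have [_ Cc Cf _] := cf_valP c.
  have [N [Ms [MM MF]]] := matching_cover Cc Cf.
  have /choice[h hM] k := matching_fun (MM k).
  exists h; split=> [k|]; first by have [] := hM k.
  by exists N => x y /MF[k kN kM]; exists k => //; have [_ + _] := hM k; exact.
have [E0 _] := cf_pairs (@inj_id nat).
pose g (p : nat * seq cf_entourage) := h (head E0 p.2) p.1.
apply: card_le_trans (card_nat_words (up_down_infinite CT)).
apply: card_le_trans (card_image_le g _).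
suff HP : [set H : set (nat -> nat) |
    H `<=` [set h | bijective h] /\
    forall A B : set nat, infinite_set A -> infinite_set B ->
      exists2 h, H h & infinite_set (h @` A `&` B)]
    (g @` [set p | words (word_card cf_entourage (upset \o downset)) p.2]).
  by have [_] := min_cardP (ex_intro _ _ HP); exact.
split=> [_ [p _ <-]|A B Ai Bi]; first exact/inv_bij/(hP _).1.
have [w wi wAB] := pairs_into (fun=> Ai) (fun=> Bi).
have [E EE] := cf_pairs wi.
have [c [G [Cc Gc GE]]] := (up_downP _).1 CT E.
have [hi [N hN]] := hP c.
apply: contrapT => no.
have fin k : finite_set (h c k @` A `&` B).
  apply: contrapT => inf; apply: no; exists (h c k) => //.
  by exists (k, [:: c]) => //; exact/wordsP.
pose D := \bigcup_(k in `I_N) (h c k @` A `&` B).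
pose D' := D `|` \bigcup_(k in `I_N) (h c k @` D).
have Df : finite_set D by apply: bigcup_finite => //; exact: finite_II.
have D'f : finite_set D'.
  rewrite finite_setU; split=> //; apply: bigcup_finite; first exact: finite_II.
  by move=> k _; exact: finite_image.
(* D' collects both ends of the pairs of c that join A to B: D contains the
   ends in B, and the involutions bring these back to A. *)
have key x y : cf_val c (x, y) -> A x -> B y -> D' x /\ D' y.
  move=> /hN[k kN kxy] Ax By; have Dy : D y by exists k => //; split=> //; exists x.
  by split; [right; exists k => //; exists y => //; rewrite -kxy hi|left].
have [_ [_ cs _] _ _] := cf_valP c; have [_ _ _ Gn] := cf_valP G; apply: Gn.
apply: sub_finite_set (finite_setX D'f D'f) => -[x y] [Gxy]; rewrite /diagonal /= => xy.
move: Gc GE; rewrite !cf_leE EE => /(_ _ Gxy) cxy /(_ _ Gxy) [//|[k /= e]].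
have [wA wB] := wAB k.
case: e => [[ex ey]|[ey ex]]; rewrite -ex -ey in wA wB.
  by have [] := key x y cxy wA wB.
by have [] := key y x (cs _ _ cxy) wA wB.
Qed.

(** * Matchings read from an infinite sequence of bits *)

(** The bits select edges, and a selected edge is kept if it meets no selected
    edge of smaller index, kept or not.  So a selected edge can be kept for
    sure by a decision on finitely many bits, and two kept edges never meet. *)
Definition kept (x : nat -> bool) a b := x (node a b) /\
  forall c d, (node c d < node a b)%N -> x (node c d) ->
    [/\ c <> a, c <> b, d <> a & d <> b].

Definition cohen_matching x a b := kept x a b \/ kept x b a.

Lemma kept_first x a b c d : kept x a b -> kept x c d ->
  [\/ c = a, c = b, d = a | d = b] -> a = c /\ b = d.
Proof.
move=> [xab ab] [xcd cd] meet; case: (ltngtP (node a b) (node c d)).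
- by move=> /cd /(_ xab)[]; case: meet; congruence.
- by move=> /ab /(_ xcd)[]; case: meet; congruence.
- exact: node_inj.
Qed.

Lemma cohen_matchingP x : matching (cohen_matching x).
Proof.
split=> [a b|a b c [h|h] [h'|h']]; first by rewrite /cohen_matching; tauto.
- by have [] := kept_first h h'; [constructor 1|].
- by have [] := kept_first h h'; [constructor 3|congruence].
- by have [] := kept_first h h'; [constructor 2|congruence].
- by have [] := kept_first h h'; [constructor 4|].
Qed.

Lemma node_bound M : exists B, forall c d, (node c d < M)%N -> (c < B)%N /\ (d < B)%N.
Proof.
pose f i := if @unpickle (nat * nat)%type i is Some p then maxn p.1 p.2 else 0%N.
exists (\max_(i < M) f i).+1 => c d cdM.
have : (f (node c d) <= \max_(i < M) f i)%N by exact: (leq_bigmax (Ordinal cdM)).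
by rewrite /f /node pickleK /=; lia.
Qed.

(** Given the bits below M, choose edges that avoid all the vertices of the
    edges of index below M, and let the next bits select these edges only: they
    are kept whatever the further bits are. *)
Lemma cohen_generic (D : (nat -> nat) -> Prop) n :
  (forall B, exists w, [/\ D w, injective w & forall k, (B <= w k)%N]) ->
  forall M (s : nat -> bool), exists M' (t : nat -> bool),
    (forall i, (i < M)%N -> t i = s i) /\
    forall x, (forall i, (i < M')%N -> x i = t i) ->
      exists2 w, D w & forall k, (k < n)%N -> kept x (w k.*2) (w k.*2.+1).
Proof.
move=> DP M s; have [B BM] := node_bound M; have [w [Dw wi Bw]] := DP B.
pose e k := node (w k.*2) (w k.*2.+1).
pose t i := if (i < M)%N then s i else `[< exists k, i = e k >].
exists (\max_(k < n) e k).+1, t; split=> [i iM|x xt]; first by rewrite /t iM.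
exists w => // k kn; have ek : (e k < (\max_(k < n) e k).+1)%N.
  by rewrite ltnS; exact: (leq_bigmax (Ordinal kn)).
have Me : ~ (e k < M)%N by move=> /BM[]; have := Bw k.*2; lia.
split=> [|c d cde xcd].
  rewrite -/(e k) xt// /t; case: ifP => // _.
  by apply/asboolP; exists k.
have [/BM[cB dB]|Mcd] := ltnP (node c d) M.
  by move: (Bw k.*2) (Bw k.*2.+1); split; lia.
move: xcd; rewrite xt; last exact: ltn_trans cde ek.
rewrite /t ltnNge Mcd /= => /asboolP[l /node_inj[cE dE]].
have kl : k <> l by move=> kl; subst; rewrite /e ltnn in cde.
by subst; split=> /wi; lia.
Qed.

Lemma fresh_pairs (E : cf_entourage) B : exists w, [/\ injective w,
  forall m, cf_val E (w m.*2, w m.*2.+1) & forall k, (B <= w k)%N].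
Proof.
have [Dc Df] := diagonal_cf; have [_ Ec Ef En] := cf_valP E.
have [_ K Kf|w [wi wE _]] := @greedy_pairs _ (fun=> [set p | cf_val E p /\
    (B <= p.1)%N /\ (B <= p.2)%N]) Dc Df.
  have KBf : finite_set (K `|` `I_B) by rewrite finite_setU; split=> //; exact: finite_II.
  have [x [y [Exy xy nx ny]]] := fresh_edge Ec Ef En KBf.
  exists x, y; split=> //=; [|by move=> Kx; apply: nx; left|by move=> Ky; apply: ny; left].
  split=> //; split; rewrite leqNgt; apply/negP => h; [apply: nx|apply: ny]; by right.
exists w; split=> [//|m|k]; first exact: (wE m).1.
have [_ [/= B1 B2]] := wE k./2.
have [->|->] : k = k./2.*2 \/ k = k./2.*2.+1 by lia.
  exact: B1.
exact: B2.
Qed.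

Definition cohen_hits (E : cf_entourage) N x := exists a b,
  [/\ cf_val E (a, b), cohen_matching x a b, a <> b & (N <= a)%N].

(** u runs along a path whose edges are alternately in E and in the matching. *)
Definition cohen_links (E : cf_entourage) n x := exists2 u : nat -> nat,
  injective u /\ (forall m, cf_val E (u m.*2, u m.*2.+1)) &
  forall k, (k < n)%N -> cohen_matching x (u k.*2.+1) (u k.*2.+2).

(** Q contains a dense open subset of the Cantor space. *)
Definition decided_densely (Q : (nat -> bool) -> Prop) :=
  forall M (s : nat -> bool), exists M' (t : nat -> bool),
    (forall i, (i < M)%N -> t i = s i) /\
    forall x, (forall i, (i < M')%N -> x i = t i) -> Q x.

Lemma cohen_hits_dense E N : decided_densely (cohen_hits E N).
Proof.
move=> M s; have [B|M' [t [ts tP]]] := @cohen_generic (fun w =>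
    [/\ cf_val E (w 0%N, w 1%N), w 0%N <> w 1%N & (N <= w 0%N)%N]) 1 _ M s.
  have [w [wi wE wB]] := fresh_pairs E (maxn N B).
  exists w; split=> // [|k]; last by have := wB k; lia.
  by split; [exact: (wE 0%N)|move=> /wi|have := wB 0%N; lia].
exists M', t; split=> // x /tP[w [Ew wn Nw] /(_ 0%N erefl) kw].
by exists (w 0%N), (w 1%N); split=> //; left.
Qed.

(** Shifting by one a sequence u whose pairs are edges of E turns these pairs
    into the gaps between them. *)
Lemma cohen_links_dense E n : decided_densely (cohen_links E n).
Proof.
move=> M s; have [B|M' [t [ts tP]]] := @cohen_generic (fun w =>
    exists2 u, injective u /\ (forall m, cf_val E (u m.*2, u m.*2.+1)) &
    w = u \o succn) n _ M s.
  have [u [ui uE uB]] := fresh_pairs E B.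
  exists (u \o succn); split=> [|i j /ui[]//|k]; [by exists u|exact: uB].
exists M', t; split=> // x /tP[w [u uP ->] kw].
by exists u => // k kn; left; exact: kw.
Qed.

Lemma cohen_meets E x : (forall N, cohen_hits E N x) ->
  nontrivial (cf_val E `&` match_ent (cohen_matching x)).
Proof.
move=> hits /(finite_image fst)/finite_ub[N NP].
have [a [b [Eab Mab ab Na]]] := hits N.
suff : (a < N)%N by lia.
by apply: NP; exists (a, b) => //; split=> //; split=> //; right.
Qed.

(** A class of G contains paths with more points than there are colours. *)
Lemma cohen_join E x G : (forall n, cohen_links E n x) -> cellular G ->
  cf_val E `<=` G -> match_ent (cohen_matching x) `<=` G -> ~ finitary G.
Proof.
move=> links Gc EG MG Gf; have [n [c [cn cG]]] := finitary_coloring Gc Gf.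
have [Gr Gs Gt] := Gc; have [u [ui uE] uM] := links n.
have walk j : (j <= n)%N -> G (u 0%N, u j).
  elim: j => [_|j ih jn]; first exact: Gr.
  apply: Gt (ih (ltnW jn)) _.
  have [[je jh]|[je jh]] : (j = j./2.*2 /\ True) \/ (j = j./2.*2.+1 /\ (j./2 < n)%N) by lia.
    by rewrite je; apply/EG/uE.
  by rewrite je; apply/MG; right; exact: uM.
suff : `I_n.+1 #<= `I_n by rewrite card_le_II ltnn.
apply: (@card_le_inj _ _ _ _ (c \o u)) => [i _|i j /= iN jN]; first exact: cn.
by move=> /cG e; apply/ui/e; apply: Gt (Gs _ _ (walk i _)) (walk j _).
Qed.

(** * Generic reals and the bounds by category *)

Section BinaryDigits.
Import Order.TTheory GRing.Theory Num.Theory numFieldNormedType.Exports.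
Local Open Scope ring_scope.
Variable R : realType.
Implicit Types r : R.

(** The reals with a given [level] at m form a half-open dyadic interval of
    length 2 ^ (- m). *)
Definition level r m : int := Num.floor (r * 2 ^+ m).

(** Parity of the absolute value is the parity of the integer, so this is the
    m-th binary digit also for negative reals. *)
Definition bit r m : bool := odd `|level r m|%N.

Lemma level_double z r m : (z <= level r m) = (2 * z <= level r m.+1).
Proof.
rewrite /level !floor_ge_int exprSr mulrA intrM [_ * z%:~R]mulrC ler_pM2r//.
Qed.

Lemma level_half r m n (b : bool) : level r m.+1 = 2 * n + b%:Z -> level r m = n.
Proof.
move=> e; have le z : (z <= level r m) = (z <= n) by rewrite level_double e; lia.
by apply/eqP; rewrite eq_le -le lexx le lexx.
Qed.

Lemma level_prev r r' m k : (k <= m)%N -> level r m = level r' m ->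
  level r k = level r' k.
Proof.
elim: m => [|m ih]; first by rewrite leqn0 => /eqP->.
rewrite leq_eqVlt => /orP[/eqP->//|km e]; apply: ih => //.
by apply/eqP; rewrite eq_le level_double -e -level_double lexx level_double e -level_double lexx.
Qed.

(** Inside a dyadic interval the next j binary digits can be prescribed. *)
Lemma level_prescribe (t : nat -> bool) M k j : exists k', forall r,
  level r (M + j) = k' -> level r M = k /\
    forall i, (M < i <= M + j)%N -> bit r i = t i.
Proof.
elim: j => [|j [k' ih]].
  by exists k => r; rewrite addn0 => ->; split=> // i; lia.
exists (2 * k' + (t (M + j).+1)%:Z) => r; rewrite addnS => e.
have [eM et] := ih r (level_half e); split=> // i /andP[Mi].
rewrite leq_eqVlt => /orP[/eqP->|ij]; last by apply: et; lia.
by rewrite /bit e; case: (t _); lia.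
Qed.

Lemma level_close r r' m : level r m = level r' m -> `|r - r'| * 2 ^+ m < 1.
Proof.
move=> e; have /andP[] := floor_itv (r * 2 ^+ m); have /andP[] := floor_itv (r' * 2 ^+ m).
rewrite -!/(level _ _) e intrD => h1 h2 h3 h4.
rewrite -[2 ^+ m]gtr0_norm ?exprn_gt0// -normrM mulrBl ltr_norml; lra.
Qed.

Lemma level_mid k m : exists r, nbhs r [set r' | level r' m = k].
Proof.
have p0 : 0 < 2 ^+ m :> R by rewrite exprn_gt0.
exists ((k%:~R + 2^-1) / 2 ^+ m); apply/nbhs_ballP.
exists (2^-1 / 2 ^+ m) => /=; first by rewrite divr_gt0 ?invr_gt0.
move=> r'; rewrite /ball /= => h; apply: floor_def.
have : `|k%:~R + 2^-1 - r' * 2 ^+ m| < 2^-1.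
  move: h; rewrite -(ltr_pM2r p0) divfK ?gt_eqF// -[X in _ * X](gtr0_norm p0) -normrM.
  by rewrite mulrBl divfK ?gt_eqF.
by rewrite ltr_norml intrD => /andP[]; lra.
Qed.

Lemma small_level (e : R) : 0 < e -> exists m, 1 < e * 2 ^+ m.
Proof.
move=> e0; exists (Num.truncn e^-1).+1.
rewrite mulrC -ltr_pdivrMr// div1r.
apply: lt_le_trans (truncnS_gt _) _; rewrite -natrX ler_nat ltnW// ltn_expl//.
Qed.

(** Every open set contains a dyadic interval; it fixes finitely many digits,
    and a smaller one fixes further digits that force Q. *)
Lemma decided_nowhere_dense (Q : (nat -> bool) -> Prop) : decided_densely Q ->
  nowhere_dense [set r | ~ Q (bit r)].
Proof.
move=> Qd; apply/seteqP; split=> // r /nbhs_ballP[e /= e0 sub].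
have [M Me] := small_level e0.
have [M' [t [ts tQ]]] := Qd M.+1 (bit r).
have [k kP] := level_prescribe t M (level r M) M'.
have [r0 r0k] := level_mid k (M + M').
have [r0M _] := kP _ (nbhs_singleton r0k).
have /sub : ball r e r0.
  rewrite /ball /=; have := level_close (esym r0M).
  have p0 : 0 < 2 ^+ M :> R by rewrite exprn_gt0.
  by move=> lt1; rewrite -(ltr_pM2r p0); apply: lt_trans Me.
move=> /(_ _ r0k)[y [/= nQ yk]]; apply: nQ; apply: tQ => i iM'.
have [yM yt] := kP _ yk; have [iM|Mi] := leqP i M; last by apply: yt; lia.
by rewrite ts// /bit (level_prev iM yM).
Qed.

Lemma nowhere_denseS (A B : set R) : A `<=` B -> nowhere_dense B -> nowhere_dense A.
Proof.
move=> AB B0; apply/seteqP; split=> // x; rewrite -[in X in _ -> X]B0.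
exact/interiorS/closureS.
Qed.

Lemma meager_cover (A : set R) (F : (set R)^nat) : (forall n, nowhere_dense (F n)) ->
  A `<=` \bigcup_n F n -> meager A.
Proof.
move=> Fn AF; exists (fun n => F n `&` A); first by move=> n; apply: nowhere_denseS (Fn n) => x [].
by rewrite -setI_bigcupl; apply/seteqP; split=> [x Ax|x []//]; split=> //; exact: AF.
Qed.

Lemma non_meagerT : ~ meager [set: R].
Proof.
case=> F Fn FT.
have /Baire : forall n, open (~` closure (F n)) /\ dense (~` closure (F n)).
  move=> n; split; first by rewrite openC; exact: closed_closure.
  move=> O [x Ox] Oo; apply: contrapT => /set0P/negP; rewrite negbK => /eqP e.
  have : O `<=` closure (F n).
    by move=> y Oy; apply: contrapT => ny; have : set0 y by rewrite -e.
  by rewrite open_subsetE// Fn => /(_ _ Ox).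
move=> /(_ setT) []; [by exists 0|exact: openT|].
move=> x [_ xF]; have [n _ Fx] : (\bigcup_n F n) x by rewrite -FT.
by apply: (xF n) => //; exact: subset_closure.
Qed.

Lemma generic_meager (Q : nat -> (nat -> bool) -> Prop) (A : set R) :
  (forall n, decided_densely (Q n)) ->
  (forall r, (forall n, Q n (bit r)) -> ~ A r) -> meager A.
Proof.
move=> Qd QA; apply: (@meager_cover _ (fun n => [set r | ~ Q n (bit r)])).
  by move=> n; exact: decided_nowhere_dense.
move=> r Ar; apply: contrapT => no; apply: (QA r) => // n.
by apply: contrapT => nQ; apply: no; exists n.
Qed.

(** The nongeneric reals whose matching is finite get an arbitrary value. *)
Lemma cohen_entourage : exists psi : R -> cf_entourage, forall r,
  nontrivial (match_ent (cohen_matching (bit r))) ->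
  cf_val (psi r) = match_ent (cohen_matching (bit r)).
Proof.
have [E0 _] := cf_pairs (@inj_id nat).
have /choice[psi psiP] (r : R) : exists E : cf_entourage,
    nontrivial (match_ent (cohen_matching (bit r))) ->
    cf_val E = match_ent (cohen_matching (bit r)).
  have [nt|] := pselect (nontrivial (match_ent (cohen_matching (bit r)))).
    by have [E EE] := cf_of (match_ent_P (@cohen_matchingP _) nt); exists E.
  by exists E0.
by exists psi.
Qed.

(** For every E, a nonmeager set contains a real whose matching has infinitely
    many edges in common with E. *)
Lemma up_down_le_non_meager : word_card cf_entourage (upset \o downset) #<= non_meager_card R.
Proof.
have [psi psiP] := cohen_entourage.
have [|Am _] := @min_cardP _ [set A : set R | ~ meager A].
  by exists setT; exact: non_meagerT.
apply: card_le_trans (card_image_le psi _); apply/word_card_le/up_downP => E.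
have [r Ar hits] : exists2 r, non_meager_card R r & forall N, cohen_hits E N (bit r).
  apply: contrapT => no; apply: Am.
  apply: (generic_meager (fun N => @cohen_hits_dense E N)) => r rE Ar.
  by apply: no; exists r.
have nt := cohen_meets hits.
have psir : cf_val (psi r) = match_ent (cohen_matching (bit r)).
  by apply: psiP; apply: nontrivialS nt => p [].
have [|G GE] := @cf_of (cf_val E `&` match_ent (cohen_matching (bit r))).
  have [Ed [Er Es Et] [n En] _] := cf_valP E.
  have [Md [Mr Ms Mt] _ _] := cf_valP (psi r).
  rewrite -psir in nt *; split=> //.
  - by move=> p pd; split; [exact: Ed|exact: Md].
  - split=> [x|x y [xy xy']|x y z [xy xy'] [yz yz']]; split=> //.
    + exact: Es.
    + exact: Ms.
    + exact: Et yz.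
    + exact: Mt yz'.
  - exists n => x; apply: card_le_trans (En x); apply: subset_card_le => y.
    by rewrite /xsection /= !inE => -[].
by exists (psi r), G; split; [exists r| |]; rewrite // cf_leE GE ?psir => p [].
Qed.

(** For each c the reals whose entourage has an upper bound in common with c
    form a meager set, and the family being cofinal in this sense, these sets
    cover the line. *)
Lemma cov_meager_le_down_up : cov_meager_card R #<= word_card cf_entourage (downset \o upset).
Proof.
have CT : (downset \o upset) (word_card cf_entourage (downset \o upset)) = setT.
  apply: (@word_cardP _ setT); apply/down_upP => E.
  by exists E, E; split=> //; rewrite cf_leE.
have [psi psiP] := cohen_entourage.
pose bad (c : cf_entourage) : set R := [set r | exists2 G : cf_entourage,
  (c <= G)%O & (psi r <= G)%O].
have HP : [set F : set (set R) | F `<=` meager /\ \bigcup_(A in F) A = [set: R]]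
    (bad @` word_card cf_entourage (downset \o upset)).
  split=> [_ [c _ <-]|].
    apply: (@generic_meager (fun n x => if odd n then cohen_hits c n./2 x
        else cohen_links c n./2 x)).
      move=> n; case: (odd n); [exact: cohen_hits_dense|exact: cohen_links_dense].
    move=> r rQ [G cG rG].
    have hits N : cohen_hits c N (bit r).
      by have := rQ N.*2.+1; rewrite /= odd_double uphalf_double.
    have links n : cohen_links c n (bit r).
      by have := rQ n.*2; rewrite odd_double doubleK.
    have [_ Gc Gf _] := cf_valP G.
    move: cG rG; rewrite !cf_leE psiP; last first.
      by apply: nontrivialS (cohen_meets hits) => p [].
    by move=> cG rG; exact: cohen_join links Gc cG rG Gf.
  apply/seteqP; split=> // r _.
  have [c [G [Cc cG rG]]] := (down_upP _).1 CT (psi r).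
  by exists (bad c); [exists c|exists G].
have [_ le] := min_cardP (ex_intro _ _ HP).
exact: card_le_trans (le _ HP) (card_image_le _ _).
Qed.
End BinaryDigits.

Theorem theorem8p1 (R : realType) :
  [/\ (word_card cf_entourage (downset \o upset \o downset) #= `I_1 /\
       word_card cf_entourage (upset \o downset \o upset) #= `I_1),
      [/\ upup cf_entourage #= continuum,
          downdown cf_entourage #= continuum,
          word_card cf_entourage downset #= continuum &
          word_card cf_entourage upset #= continuum],
      (cov_meager_card R #<= word_card cf_entourage (downset \o upset) /\
       word_card cf_entourage (downset \o upset) #<= Delta_hat_card) &
      (Sigma_card #<= word_card cf_entourage (upset \o downset) /\
       word_card cf_entourage (upset \o downset) #<= non_meager_card R)].
Proof.
split; [exact: three_letter_words_card|exact: antichains_and_cofinality_card|split|split].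
- exact: cov_meager_le_down_up.
- exact: down_up_le_Delta_hat.
- exact: Sigma_le_up_down.
- exact: up_down_le_non_meager.
Qed.
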